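(* Let $M=\langle S,A,P,r,\mu,\gamma\rangle$ be a finite Markov decision process, $\phi_1,\phi_2$ propositional logic formulas over atomic propositions labelling the states, $p\in[0,1]$, and $\bowtie\,\in\{\le,\ge,>,<\}$. Define the cost function $d:S\times A\to\mathbb{R}$ by $d(s,a)=\mathbf{E}_{s'\sim P(\cdot\mid s,a)}\mathbf{1}(s'\models\phi_2)$ if $s\not\models\phi_2$, and $d(s,a)=0$ otherwise. Let all states in $\{s\in S\mid s\models\phi_1\lor\phi_2\}$ be sink states. Let $\pi$ be a Markov randomized policy, let $\epsilon\in(0,1)$, and let $T_\epsilon$ be an upper bound of the $\epsilon$-return mixing time of $\pi$. Then the $\pi$-induced Markov chain satisfies $M^\pi\models P_{\bowtie p}(\neg\phi_1\ \mathsf{U}\ \phi_2)$ if one of the following cases holds: - $\bowtie\,\in\{\ge,>\}$ and $D(X_0,T_\epsilon;\pi)\bowtie p$; - $\bowtie\,\in\{\le,<\}$ and $D(X_0,T_\epsilon;\pi)\bowtie p-\epsilon$.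
   Context: $S,A$ are finite, $P(\cdot\mid s,a)$ is the next-state distribution, $\mu$ the initial distribution. A state $s$ is a sink state if $P(s\mid s,a)=1$ for all admissible actions $a$ at $s$. A Markov randomized policy $\pi$ assigns to each state a distribution over admissible actions; $M^\pi=\{X_n,n\ge0\}$ with actions $A_n$ is the induced Markov chain, $X_0\sim\mu$, $A_t\sim\pi(\cdot\mid X_t)$, $X_{t+1}\sim P(\cdot\mid X_t,A_t)$. $s\models\phi$ means the state $s$ satisfies $\phi$. A path $s_0s_1s_2\ldots$ satisfies $\neg\phi_1\ \mathsf{U}\ \phi_2$ iff there is $j\ge0$ with $s_j\models\phi_2$ and $s_i\not\models\phi_1$ for all $0\le i<j$. $M^\pi\models P_{\bowtie p}(\psi)$ means that the probability that the path of $M^\pi$ started at $X_0$ satisfies $\psi$ is $\bowtie p$. $D(s,T;\pi)$ is the expected undiscounted total cost $\mathbf{E}_\pi\big[\sum_{t=0}^{T-1}d(X_t,A_t)\mid X_0=s\big]$, $T\in\mathbb{N}\cup\{\infty\}$ (the discount factor is set to $1$ for the cost), and $D(X_0,T;\pi)$ is the same quantity when starting at $X_0$. Mixing time: given $\epsilon>0$, the $\epsilon$-return mixing time of $\pi$ is the smallest $T$ such that for all $T'\ge T$ (and all $s\in S$), $|D(s,T';\pi)-D(s,T;\pi)|\le\epsilon$. (The paper introduces this notion for an ergodic policy $\pi$; here it is applied to the given $\pi$.)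
   Formalization: In the case ⋈ ∈ {≤,<} the formal theorem adds that μ(s)=0 for every state s satisfying φ2; without it the claim fails, e.g. for a single sink state satisfying φ2, where the cost D is 0 but the until probability is 1. *)

(* Defs.v *)
From HB Require Import structures.
From mathcomp Require Import all_boot all_order all_algebra.
From mathcomp Require Import all_classical all_reals all_analysis.
Set Implicit Arguments.
Unset Strict Implicit.
Unset Printing Implicit Defensive.
Import Order.TTheory GRing.Theory Num.Theory.

Local Open Scope classical_set_scope.
Local Open Scope ring_scope.

(* [trans s a] is constrained only for the actions [a] admissible at [s].
   [rew] and [gamma] play no role for the undiscounted cost below; no range is
   imposed on [gamma]. *)
Record mdp (R : realType) (S A : finType) := Mdp {
  adm : S -> {set A};
  trans : S -> A -> S -> R;
  rew : S -> A -> R;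
  init : S -> R;
  gamma : R;
  trans_ge0 : forall s a s', a \in adm s -> 0 <= trans s a s';
  trans_sum1 : forall s a, a \in adm s -> \sum_s' trans s a s' = 1;
  init_ge0 : forall s, 0 <= init s;
  init_sum1 : \sum_s init s = 1 }.

Definition is_sink (R : realType) (S A : finType) (M : mdp R S A) (s : S) :=
  forall a, a \in adm M s -> trans M s a s = 1.

Record policy (R : realType) (S A : finType) (M : mdp R S A) := Policy {
  pol :> S -> A -> R;
  pol_ge0 : forall s a, 0 <= pol s a;
  pol_adm : forall s a, a \notin adm M s -> pol s a = 0;
  pol_sum1 : forall s, \sum_a pol s a = 1 }.

Inductive pform (AP : Type) :=
  | PTrue
  | PAtom of AP
  | PNot of pform AP
  | PAnd of pform AP & pform AP
  | POr of pform AP & pform AP.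

(* [lab s x] holds when the atomic proposition [x] labels the state [s]. *)
Fixpoint sat (S AP : Type) (lab : S -> pred AP) (s : S) (phi : pform AP)
    : bool :=
  match phi with
  | PTrue => true
  | PAtom x => lab s x
  | PNot f => ~~ sat lab s f
  | PAnd f g => sat lab s f && sat lab s g
  | POr f g => sat lab s f || sat lab s g
  end.

(* The path formula [~ phi1 U phi2]. *)
Definition not_until (S AP : Type) (lab : S -> pred AP) (phi1 phi2 : pform AP)
    (path : nat -> S) : Prop :=
  exists j, sat lab (path j) phi2 /\
    forall i, (i < j)%N -> ~~ sat lab (path i) phi1.

(* Histories s_0 a_0 ... s_t and s_0 a_0 ... s_t a_t. *)
Definition hist (Om S A : Type) (X : nat -> Om -> S) (Act : nat -> Om -> A)
    (x : nat -> S) (a : nat -> A) (t : nat) : set Om :=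
  [set w | (forall i, (i <= t)%N -> X i w = x i) /\
           (forall i, (i < t)%N -> Act i w = a i)].

Definition hist_act (Om S A : Type) (X : nat -> Om -> S) (Act : nat -> Om -> A)
    (x : nat -> S) (a : nat -> A) (t : nat) : set Om :=
  [set w | (forall i, (i <= t)%N -> X i w = x i) /\
           (forall i, (i <= t)%N -> Act i w = a i)].

(* A realization, on some probability space, of the controlled process with
   X_0 ~ nu, A_t ~ pi(.|X_t) and X_{t+1} ~ P(.|X_t,A_t), the last two given the
   whole past; conditional laws are written multiplicatively, so that null
   histories need no special treatment. *)
Record induced_chain (R : realType) (S A : finType) (M : mdp R S A)
    (pi : policy M) (nu : S -> R) := InducedChain {
  chain_disp : measure_display;
  chain_space : measurableType chain_disp;
  chain_pr : probability chain_space R;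
  chain_state : nat -> chain_space -> S;
  chain_act : nat -> chain_space -> A;
  chain_state_meas : forall t s, measurable (chain_state t @^-1` [set s]);
  chain_act_meas : forall t a, measurable (chain_act t @^-1` [set a]);
  chain_init : forall s, chain_pr (chain_state 0 @^-1` [set s]) = (nu s)%:E;
  chain_choose : forall (x : nat -> S) (a : nat -> A) t,
    chain_pr (hist_act chain_state chain_act x a t) =
    (chain_pr (hist chain_state chain_act x a t) * (pi (x t) (a t))%:E)%E;
  chain_step : forall (x : nat -> S) (a : nat -> A) t,
    chain_pr (hist chain_state chain_act x a t.+1) =
    (chain_pr (hist_act chain_state chain_act x a t) *
     (trans M (x t) (a t) (x t.+1))%:E)%E }.

Arguments chain_state {R S A M pi nu} _ _ _.
Arguments chain_act {R S A M pi nu} _ _ _.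

Definition point_mass (R : realType) (S : finType) (s : S) : S -> R :=
  fun s' => (s' == s)%:R.

Inductive comparison_op := CmpLe | CmpGe | CmpGt | CmpLt.

Definition cmp (R : realType) (b : comparison_op) (x y : \bar R) : Prop :=
  match b with
  | CmpLe => (x <= y)%E
  | CmpGe => (x >= y)%E
  | CmpGt => (x > y)%E
  | CmpLt => (x < y)%E
  end.

(* Satisfaction of the formula P_{b p}(psi) by the chain. *)
Definition chain_models (R : realType) (S A : finType) (M : mdp R S A)
    (pi : policy M) (nu : S -> R) (C : induced_chain pi nu)
    (b : comparison_op) (p : R) (psi : (nat -> S) -> Prop) : Prop :=
  cmp b (chain_pr C [set w | psi (fun n => chain_state C n w)]) p%:E.

(* The expected undiscounted cost up to T, for the initial law of C. *)
Definition total_cost (R : realType) (S A : finType) (M : mdp R S A)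
    (pi : policy M) (nu : S -> R) (C : induced_chain pi nu)
    (d : S -> A -> R) (T : nat) : \bar R :=
  ('E_(chain_pr C)
     [fun w => (\sum_(t < T) d (chain_state C t w) (chain_act C t w))%R])%E.

Definition reach_cost (R : realType) (S A : finType) (M : mdp R S A)
    (AP : Type) (lab : S -> pred AP) (phi2 : pform AP) (s : S) (a : A) : R :=
  if sat lab s phi2 then 0
  else \sum_s' trans M s a s' * (sat lab s' phi2)%:R.

(* In the next two definitions [D s T] stands for the cost up to T from s. *)
Definition return_settled (R : realType) (S : finType) (D : S -> nat -> \bar R)
    (eps : R) (T : nat) : Prop :=
  forall T', (T <= T')%N -> forall s, (`|D s T' - D s T| <= eps%:E)%E.

Definition is_return_mixing_time (R : realType) (S : finType)
    (D : S -> nat -> \bar R) (eps : R) (T : nat) : Prop :=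
  return_settled D eps T /\
  forall T0, return_settled D eps T0 -> (T <= T0)%N.

(* The cost [reach_cost] counts the transitions entering phi2, hence not the
   runs that start in phi2, although these satisfy the until formula. Upper
   bounds on the cost therefore bound the until probability only when X_0
   avoids phi2 almost surely: for a single state satisfying phi2, the cost is 0
   and the probability 1. *)
Definition init_avoids (R : realType) (S A : finType) (M : mdp R S A)
    (AP : Type) (lab : S -> pred AP) (phi2 : pform AP) : Prop :=
  forall s, sat lab s phi2 -> init M s = 0.

(* Main.v *)
Require Import Defs.
From HB Require Import structures.
From mathcomp Require Import all_boot all_order all_algebra.
From mathcomp Require Import all_classical all_reals all_analysis.
From mathcomp Require Import lra.
Set Implicit Arguments.
Unset Strict Implicit.
Unset Printing Implicit Defensive.
Import Order.TTheory GRing.Theory Num.Theory.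
Local Open Scope ring_scope.
Local Open Scope classical_set_scope.

(** The cost [reach_cost] has a potential.  Let [K s s'] be the one-step
    probability of going from [s] to [s'] under the policy ([kern]).  The mean
    cost paid in [s] is the [K s]-mean of the indicator of [phi2], minus that
    indicator at [s]: outside [phi2] this is the definition of the cost, and
    inside both sides vanish because [phi2] states are sinks
    ([reach_cost_mean]).  The expected cost therefore telescopes to
    [P(X_T |= phi2) - P(X_0 |= phi2)] ([total_reach_cost]), with
    [P(X_t |= phi2)] nondecreasing in [t].

    Almost surely the path makes only moves of positive [K]-probability, and
    then it never leaves a sink.  Along such a path the events [X_t |= phi2]
    increase with [t], and [phi1] cannot hold before the first visit to [phi2],
    since the path would be stuck in a state violating [phi2].  Up to a null
    set, the until event is thus the increasing union of the events
    [X_t |= phi2].  Its probability is at least [P(X_T |= phi2)], hence at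
    least the cost up to any [T] ([until_ge]), and at most any common upper
    bound of these probabilities ([until_le]).

    For the upper bounds, the mixing time controls the cost from each single
    initial state.  The law of [X_t] depends linearly on the law of [X_0]
    ([occ_linear]), so averaging over [init M] gives
    [P(X_t |= phi2) <= P(X_T |= phi2) + eps] for all [t], as soon as [T] is at
    least the mixing time ([mixing_bound]).  When [X_0] avoids [phi2], the
    right-hand side is the cost up to [T] plus [eps]. *)

(** * Expectations and probabilities over finitely many values *)

Lemma expectation_simple (d : measure_display) (T : measurableType d)
    (R : realType) (P : probability T R) (I : finType) (c : I -> R)
    (A : I -> set T) (mA : forall i, measurable (A i)) :
  ('E_P[fun w => (\sum_i c i * \1_(A i) w)%R])%E =
  (\sum_i c i * fine (P (A i)))%:E.
Proof.
rewrite unlock -sumEFin.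
have iA i : P.-integrable setT (fun w => (c i)%:E * (\1_(A i) w)%:E)%E.
  by apply: integrableZl => //; exact: integrable_indic.
under eq_integral => w _ do rewrite -sumEFin.
under eq_integral => w _ do under eq_bigr => i _ do rewrite EFinM.
rewrite (integral_sum measurableT iA); apply: eq_bigr => i _.
rewrite integralZl//; last exact: integrable_indic.
by rewrite integral_indic// setIT EFinM fineK// fin_num_measure.
Qed.

Lemma prob_partition (d : measure_display) (T : measurableType d)
    (R : realType) (P : probability T R) (I : finType) (Y : T -> I)
    (E : set T) (mE : measurable E)
    (mEY : forall c, measurable (E `&` Y @^-1` [set c])) :
  fine (P E) = \sum_c fine (P (E `&` Y @^-1` [set c])).
Proof.
apply: EFin_inj; rewrite fineK ?fin_num_measure//.
rewrite -(expectation_indic P mE).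
transitivity ('E_P[fun w => (\sum_c 1 * \1_(E `&` Y @^-1` [set c]) w)%R])%E.
  congr expectation; apply/funext => w.
  rewrite (bigD1 (Y w))//= big1 ?addr0 ?mul1r => [|c /eqP cY].
    by rewrite !indicE in_setI [X in _ && X]mem_set ?andbT.
  rewrite indicE memNset ?mulr0// => -[_ /= Yc]; exact/cY/esym.
by rewrite expectation_simple//; congr EFin; apply: eq_bigr => c _; rewrite mul1r.
Qed.

Lemma measurable_fiber (d : measure_display) (T : measurableType d)
    (I : finType) (Y : T -> I)
    (mY : forall c, measurable (Y @^-1` [set c])) (B : set I) :
  measurable (Y @^-1` B).
Proof.
have -> : Y @^-1` B = \bigcup_(c in B) Y @^-1` [set c].
  by apply/seteqP; split=> [w Bw|w [c Bc /= ->]]; first by exists (Y w).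
by apply: fin_bigcup_measurable => //; exact: finite_finset.
Qed.

(** * The transition kernel of a policy *)

Definition kern (R : realType) (S A : finType) (M : mdp R S A)
    (pi : policy M) (s s' : S) : R := \sum_a pi s a * trans M s a s'.

(** Off the admissible actions [trans] is arbitrary, but there [pol] vanishes. *)
Lemma kern_term_ge0 (R : realType) (S A : finType) (M : mdp R S A)
    (pi : policy M) s a s' : 0 <= pi s a * trans M s a s'.
Proof.
have [aM|aM] := boolP (a \in adm M s); last by rewrite pol_adm// mul0r.
by rewrite mulr_ge0 ?pol_ge0 ?trans_ge0.
Qed.

Lemma kern_ge0 (R : realType) (S A : finType) (M : mdp R S A)
    (pi : policy M) s s' : 0 <= kern pi s s'.
Proof. by apply: sumr_ge0 => a _; exact: kern_term_ge0. Qed.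

Lemma pol_trans_sum (R : realType) (S A : finType) (M : mdp R S A)
    (pi : policy M) s a : \sum_s' pi s a * trans M s a s' = pi s a.
Proof.
have [aM|aM] := boolP (a \in adm M s).
  by rewrite -mulr_sumr trans_sum1// mulr1.
by rewrite pol_adm// big1// => s' _; rewrite mul0r.
Qed.

Lemma kern_sum1 (R : realType) (S A : finType) (M : mdp R S A)
    (pi : policy M) s : \sum_s' kern pi s s' = 1.
Proof.
rewrite exchange_big -(pol_sum1 pi s); apply: eq_bigr => a _.
exact: pol_trans_sum.
Qed.

Lemma kern_sink1 (R : realType) (S A : finType) (M : mdp R S A)
    (pi : policy M) s (sM : is_sink M s) : kern pi s s = 1.
Proof.
rewrite -(pol_sum1 pi s); apply: eq_bigr => a _.
have [aM|aM] := boolP (a \in adm M s); first by rewrite sM// mulr1.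
by rewrite pol_adm// mul0r.
Qed.

Lemma kern_sink0 (R : realType) (S A : finType) (M : mdp R S A)
    (pi : policy M) s s' (sM : is_sink M s) : s' != s -> kern pi s s' = 0.
Proof.
move=> s's; have := kern_sum1 pi s.
rewrite (bigD1 s)//= kern_sink1// -{2}[1]addr0 => /addrI /eqP.
rewrite psumr_eq0 => [/allP/(_ s' (mem_index_enum _))|? _]; last exact: kern_ge0.
by rewrite s's => /eqP.
Qed.

(** * One-step laws of the induced chain *)

(** Extends a finite history to the infinite sequences that [hist] expects. *)
Definition splice (T : Type) (n : nat) (f : 'I_n -> T) (u : nat -> T) i :=
  if insub i is Some j then f j else u i.

Lemma splice_ord (T : Type) (n : nat) (f : 'I_n -> T) u (i : 'I_n) :
  splice f u i = f i.
Proof. by rewrite /splice valK. Qed.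

Lemma splice_ge (T : Type) (n : nat) (f : 'I_n -> T) u i :
  (n <= i)%N -> splice f u i = u i.
Proof. by move=> ni; rewrite /splice insubF// ltnNge ni. Qed.

Lemma splice_eq (T : Type) (n : nat) (f : 'I_n -> T) u (v : nat -> T) :
  (forall i, (i < n)%N -> v i = splice f u i) <-> (forall i : 'I_n, v i = f i).
Proof.
split=> H i; first by rewrite H ?splice_ord.
by move=> ni; rewrite -[i]/(val (Ordinal ni)) splice_ord H.
Qed.

Section chain.
Context {R : realType} {S A : finType} {M : mdp R S A} { pi : policy M}
  {nu : S -> R} (C : induced_chain pi nu).

Local Notation X := (chain_state C).
Local Notation Act := (chain_act C).
Local Notation P := (chain_pr C).

Lemma measurable_hist x a t : measurable (hist X Act x a t).
Proof.
have -> : hist X Act x a t =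
    (\bigcap_(i in [set i | (i <= t)%N]) (X i @^-1` [set x i])) `&`
    (\bigcap_(i in [set i | (i < t)%N]) (Act i @^-1` [set a i])) by [].
by apply: measurableI; apply: bigcap_measurableType => i _;
  [exact: chain_state_meas|exact: chain_act_meas].
Qed.

Definition occ t s : R := fine (P (X t @^-1` [set s])).

Lemma occ_ge0 t s : 0 <= occ t s.
Proof. by rewrite fine_ge0. Qed.

Lemma occ0 s : occ 0 s = nu s.
Proof. by rewrite /occ chain_init. Qed.

Definition transition_event t s a s' :=
  [set w | [/\ X t w = s, Act t w = a & X t.+1 w = s']].

Lemma measurable_transition_event t s a s' :
  measurable (transition_event t s a s').
Proof.
have -> : transition_event t s a s' =
    X t @^-1` [set s] `&` Act t @^-1` [set a] `&` X t.+1 @^-1` [set s'].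
  by apply/seteqP; split => w /= => [[]|[[]]].
by do !apply: measurableI;
  [exact: chain_state_meas|exact: chain_act_meas|exact: chain_state_meas].
Qed.

Definition past t w : {ffun 'I_t -> S} * {ffun 'I_t -> A} :=
  ([ffun i : 'I_t => X i w], [ffun i : 'I_t => Act i w]).

Lemma pastE t (c : {ffun 'I_t -> S} * {ffun 'I_t -> A}) u v w :
  past t w = c <->
  (forall i, (i < t)%N -> X i w = splice c.1 u i) /\
  (forall i, (i < t)%N -> Act i w = splice c.2 v i).
Proof.
rewrite (splice_eq c.1 u (X ^~ w)) (splice_eq c.2 v (Act ^~ w)).
split=> [<-|]; first by split=> i; rewrite ffunE.
by case: c => f g [/= Hf Hg]; congr pair; apply/ffunP => i; rewrite ffunE.
Qed.

(** With [u] prescribing the current state, the histories of length [t] cut the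
    event that [X_t] equals [u t] into pieces whose probabilities the axioms of
    the chain control; [transition_past] does the same one step later. *)
Lemma hist_past t (c : {ffun 'I_t -> S} * {ffun 'I_t -> A}) u v :
  X t @^-1` [set u t] `&` past t @^-1` [set c] =
  hist X Act (splice c.1 u) (splice c.2 v) t.
Proof.
apply/seteqP; split=> w /=.
  move=> [Xt /(pastE c u v)[Hx Ha]]; split=> // i.
  by rewrite leq_eqVlt => /predU1P[->|/Hx//]; rewrite splice_ge.
move=> [Hx Ha]; split; first by rewrite /= Hx// splice_ge.
by apply/(pastE c u v); split=> // i it; rewrite Hx// ltnW.
Qed.

Lemma transition_past t (c : {ffun 'I_t -> S} * {ffun 'I_t -> A}) u v :
  transition_event t (u t) (v t) (u t.+1) `&` past t @^-1` [set c] =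
  hist X Act (splice c.1 u) (splice c.2 v) t.+1.
Proof.
apply/seteqP; split=> w /=.
  move=> [[Xt At Xt1] /(pastE c u v)[Hx Ha]]; split=> i.
    rewrite leq_eqVlt => /predU1P[->|]; first by rewrite splice_ge.
    by rewrite ltnS leq_eqVlt => /predU1P[->|/Hx//]; rewrite splice_ge.
  by rewrite ltnS leq_eqVlt => /predU1P[->|/Ha//]; rewrite splice_ge.
move=> [Hx Ha]; split.
  by split; rewrite ?Hx ?Ha ?splice_ge.
apply/(pastE c u v); split=> i it; first by rewrite Hx// ltnW// ltnW.
by rewrite Ha// ltnW.
Qed.

(** The Markov property in the only form used: the axioms multiply the
    probability of every full history by the same factor, so summing over the
    past leaves the law of [X_t] times that factor. *)
Lemma chain_transition t s a s' :
  fine (P (transition_event t s a s')) = occ t s * (pi s a * trans M s a s').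
Proof.
(* Only the values of [u] at [t] and [t.+1] matter, and that of [v] at [t]. *)
pose u i := if i == t then s else s'; pose v (_ : nat) := a.
have ut : u t = s by rewrite /u eqxx.
have ut1 : u t.+1 = s' by rewrite /u gtn_eqF.
have mh c : transition_event t s a s' `&` past t @^-1` [set c] =
    hist X Act (splice c.1 u) (splice c.2 v) t.+1.
  by rewrite -transition_past ut ut1.
have hh c : X t @^-1` [set s] `&` past t @^-1` [set c] =
    hist X Act (splice c.1 u) (splice c.2 v) t.
  by rewrite -hist_past ut.
rewrite (@prob_partition _ _ _ _ _ (past t)); first last.
- by move=> c; rewrite mh; exact: measurable_hist.
- exact: measurable_transition_event.
rewrite /occ (@prob_partition _ _ _ _ _ (past t)); first last.
- by move=> c; rewrite hh; exact: measurable_hist.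
- exact: chain_state_meas.
rewrite mulr_suml; apply: eq_bigr => c _.
rewrite mh hh chain_step chain_choose.
rewrite !splice_ge// ut ut1 !fineM ?fin_num_measure ?mulrA//.
- exact: measurable_hist.
- by rewrite fin_numM// fin_num_measure//; exact: measurable_hist.
Qed.

Lemma occ_act t s a :
  fine (P (X t @^-1` [set s] `&` Act t @^-1` [set a])) = occ t s * pi s a.
Proof.
have E s' : X t @^-1` [set s] `&` Act t @^-1` [set a] `&` X t.+1 @^-1` [set s']
    = transition_event t s a s'.
  by apply/seteqP; split => w /= => [[[]]|[]].
rewrite (@prob_partition _ _ _ _ _ (X t.+1)); first last.
- by move=> s'; rewrite E; exact: measurable_transition_event.
- by apply: measurableI; [exact: chain_state_meas|exact: chain_act_meas].
under eq_bigr do rewrite E chain_transition.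
by rewrite -mulr_sumr pol_trans_sum.
Qed.

Lemma occ_pair t s s' :
  fine (P (X t @^-1` [set s] `&` X t.+1 @^-1` [set s'])) =
  occ t s * kern pi s s'.
Proof.
have E a : X t @^-1` [set s] `&` X t.+1 @^-1` [set s'] `&` Act t @^-1` [set a]
    = transition_event t s a s'.
  by apply/seteqP; split => w /= => [[[]]|[]].
rewrite (@prob_partition _ _ _ _ _ (Act t)); first last.
- by move=> a; rewrite E; exact: measurable_transition_event.
- by apply: measurableI; exact: chain_state_meas.
by under eq_bigr do rewrite E chain_transition; rewrite -mulr_sumr.
Qed.

Lemma occS t s' : occ t.+1 s' = \sum_s occ t s * kern pi s s'.
Proof.
rewrite {1}/occ (@prob_partition _ _ _ _ _ (X t)); first last.
- by move=> s; apply: measurableI; exact: chain_state_meas.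
- exact: chain_state_meas.
by apply: eq_bigr => s _; rewrite setIC occ_pair.
Qed.

Lemma total_costE d T :
  total_cost C d T = (\sum_(t < T) \sum_s occ t s * \sum_a pi s a * d s a)%:E.
Proof.
pose F (i : 'I_T * (S * A)) := X i.1 @^-1` [set i.2.1] `&` Act i.1 @^-1` [set i.2.2].
have mF i : measurable (F i).
  by apply: measurableI; [exact: chain_state_meas|exact: chain_act_meas].
transitivity ('E_P[fun w => (\sum_i d i.2.1 i.2.2 * \1_(F i) w)%R])%E.
  congr expectation; apply/funext => w.
  rewrite -(pair_bigA _ (fun t c => d c.1 c.2 * \1_(F (t, c)) w)).
  apply: eq_bigr => t _.
  rewrite (bigD1 (X t w, Act t w))//= big1 ?addr0 => [|[s a] /eqP sa].
    by rewrite indicE mem_set ?mulr1.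
  by rewrite indicE memNset ?mulr0// => -[/= Xt At]; apply: sa; rewrite Xt At.
rewrite expectation_simple//; congr EFin.
rewrite -(pair_bigA _ (fun t c => d c.1 c.2 * fine (P (F (t, c))))).
apply: eq_bigr => t _.
rewrite -(pair_bigA _ (fun s a => d s a * fine (P (F (t, (s, a)))))).
apply: eq_bigr => s _; rewrite mulr_sumr; apply: eq_bigr => a _.
by rewrite occ_act mulrC mulrA.
Qed.

(** The probability that [X_t] lies in [B], as a real number; see [occ_inE]. *)
Definition occ_in (B : pred S) t : R := \sum_s occ t s * (B s)%:R.

Lemma occ_inE (B : pred S) t : P [set w | B (X t w)] = (occ_in B t)%:E.
Proof.
have mB : measurable [set w | B (X t w)].
  exact: (measurable_fiber (chain_state_meas C t) [set s | B s]).
rewrite -(fineK (fin_num_measure P _ mB)); congr EFin.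
have E s : [set w | B (X t w)] `&` X t @^-1` [set s] =
    if B s then X t @^-1` [set s] else set0.
  apply/seteqP; split=> w /=; first by move=> [+ Xt]; rewrite Xt => ->.
  by case: ifP => // Bs /= ->.
rewrite (@prob_partition _ _ _ _ _ (X t))//; last first.
  by move=> s; rewrite E; case: ifP => // _; exact: chain_state_meas.
apply: eq_bigr => s _; rewrite E; case: ifP => _; first by rewrite mulr1.
by rewrite measure0 mulr0.
Qed.

End chain.

Arguments occ {R S A M pi nu} C t s.
Arguments occ_in {R S A M pi nu} C B t.

(** * The reachability cost as a difference of hitting probabilities *)

(** Both sides satisfy the recursion [occS], which is linear, with the same
    initial value. *)
Lemma occ_linear (R : realType) (S A : finType) (M : mdp R S A)
    (pi : policy M) (nu : S -> R) (C : induced_chain pi nu)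
    (Cs : forall s, induced_chain pi (point_mass R s)) t s :
  occ C t s = \sum_s0 nu s0 * occ (Cs s0) t s.
Proof.
elim: t s => [|t IH] s.
  rewrite occ0 (bigD1 s)//= big1 ?addr0 => [|s0 s0s].
    by rewrite occ0 /point_mass eqxx mulr1.
  by rewrite occ0 /point_mass eq_sym (negPf s0s) mulr0.
rewrite occS; under eq_bigr do rewrite IH mulr_suml.
rewrite exchange_big; apply: eq_bigr => s0 _.
rewrite occS mulr_sumr; apply: eq_bigr => s1 _.
by rewrite mulrA.
Qed.

(** The right-hand side is the drift of the indicator of [phi].  On [phi] it
    vanishes because the state is a sink, in accordance with the zero cost. *)
Lemma reach_cost_mean (R : realType) (S A : finType) (M : mdp R S A)
    (pi : policy M) (AP : Type) (lab : S -> pred AP) (phi : pform AP)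
    (sinkphi : forall s, sat lab s phi -> is_sink M s) s :
  \sum_a pi s a * reach_cost M lab phi s a =
  \sum_s' kern pi s s' * (sat lab s' phi)%:R - (sat lab s phi)%:R.
Proof.
rewrite /reach_cost; case sphi: (sat lab s phi).
  rewrite big1 => [|a _]; last by rewrite mulr0.
  rewrite (bigD1 s)//= big1 => [|s' s's]; last first.
    by rewrite kern_sink0 ?mul0r//; exact: sinkphi.
  by rewrite sphi kern_sink1 ?mulr1 ?addr0 ?subrr//; exact: sinkphi.
rewrite subr0; under eq_bigr do rewrite mulr_sumr.
rewrite exchange_big; apply: eq_bigr => s' _; rewrite mulr_suml.
by apply: eq_bigr => a _; rewrite mulrA.
Qed.

Section reaching.
Context {R : realType} {S A : finType} {M : mdp R S A} { pi : policy M}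
  {AP : Type} {lab : S -> pred AP} {phi : pform AP}
  (sinkphi : forall s, sat lab s phi -> is_sink M s).

Local Notation B := (fun s => sat lab s phi).

Lemma occ_in_incr (nu : S -> R) (C : induced_chain pi nu) t :
  occ_in C B t.+1 - occ_in C B t =
  \sum_s occ C t s * \sum_a pi s a * reach_cost M lab phi s a.
Proof.
under eq_bigr => s _ do rewrite (reach_cost_mean pi sinkphi) mulrBr.
rewrite sumrB; congr (_ - _); rewrite /occ_in.
under eq_bigr do rewrite occS mulr_suml.
rewrite exchange_big; apply: eq_bigr => s _; rewrite mulr_sumr.
by apply: eq_bigr => s' _; rewrite mulrA.
Qed.

Lemma total_reach_cost (nu : S -> R) (C : induced_chain pi nu) T :
  total_cost C (reach_cost M lab phi) T = (occ_in C B T - occ_in C B 0)%:E.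
Proof.
rewrite total_costE -(telescope_sumr (occ_in C B)) // big_mkord.
by congr EFin; apply: eq_bigr => t _; rewrite occ_in_incr.
Qed.

(** The increments are mean costs, and an action that the policy takes with
    positive probability is admissible, hence of nonnegative cost. *)
Lemma occ_in_nd (nu : S -> R) (C : induced_chain pi nu) t t' :
  (t <= t')%N -> occ_in C B t <= occ_in C B t'.
Proof.
move: t t'; apply/nondecreasing_seqP => n; rewrite -subr_ge0 occ_in_incr.
apply: sumr_ge0 => s _.
rewrite mulr_ge0 ?occ_ge0//; apply: sumr_ge0 => a _; rewrite /reach_cost.
case: ifP => _; first by rewrite mulr0.
rewrite mulr_sumr; apply: sumr_ge0 => s' _.
by rewrite mulrA mulr_ge0// ?kern_term_ge0.
Qed.

(** By linearity in the initial law it is enough to compare the times [T] and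
    [maxn T t] from each state; by monotonicity, replacing [T] with the
    earlier time [T0] only widens the gap, and [mixT0] bounds the wider one. *)
Lemma mixing_bound (nu : S -> R) (nu_ge0 : forall s, 0 <= nu s)
    (nu_sum1 : \sum_s nu s = 1) (C : induced_chain pi nu)
    (Cs : forall s, induced_chain pi (point_mass R s)) eps T0 T t
    (mixT0 : return_settled
      (fun s T => total_cost (Cs s) (reach_cost M lab phi) T) eps T0) :
  (T0 <= T)%N -> occ_in C B t - occ_in C B T <= eps.
Proof.
move=> T0T.
have {}mixT0 s n : occ_in (Cs s) B (maxn T n) - occ_in (Cs s) B T <= eps.
  have := mixT0 (maxn T n) (leq_trans T0T (leq_maxl _ _)) s.
  rewrite !total_reach_cost -EFinB /= lee_fin => /ler_normlW.
  have := occ_in_nd (Cs s) T0T; lra.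
have mixture n : occ_in C B n = \sum_s nu s * occ_in (Cs s) B n.
  rewrite /occ_in; under eq_bigr do rewrite (occ_linear C Cs) mulr_suml.
  rewrite exchange_big; apply: eq_bigr => s _; rewrite mulr_sumr.
  by apply: eq_bigr => s' _; rewrite mulrA.
have /(occ_in_nd C) tT := leq_maxr T t.
apply: (le_trans (lerB tT (lexx _))).
rewrite !mixture -sumrB -[eps]mul1r -nu_sum1 mulr_suml.
by apply: ler_sum => s _; rewrite -mulrBr ler_wpM2l.
Qed.

End reaching.

(** * The until event *)

Section until.
Context {R : realType} {S A : finType} {M : mdp R S A} { pi : policy M}
  {nu : S -> R} (C : induced_chain pi nu)
  {AP : Type} {lab : S -> pred AP} {phi1 phi2 : pform AP}
  (hsink : forall s, sat lab s (POr phi1 phi2) -> is_sink M s).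

Local Notation X := (chain_state C).
Local Notation P := (chain_pr C).
Local Notation B := (fun s => sat lab s phi2).

Let sinkphi1 s : sat lab s phi1 -> is_sink M s.
Proof. by move=> s1; apply: hsink; rewrite /= s1. Qed.

Let sinkphi2 s : sat lab s phi2 -> is_sink M s.
Proof. by move=> s2; apply: hsink; rewrite /= s2 orbT. Qed.

Definition forbidden t := [set w | kern pi (X t w) (X t.+1 w) = 0].

(** The exceptional null set: outside it, sinks are never left. *)
Definition stray := \bigcup_t forbidden t.

Lemma measurable_forbidden t : measurable (forbidden t).
Proof.
apply: (@measurable_fiber _ _ _ (fun w => (X t w, X t.+1 w)) _
  [set c | kern pi c.1 c.2 = 0]) => -[s s'].
have -> : (fun w => (X t w, X t.+1 w)) @^-1` [set (s, s')] =
    X t @^-1` [set s] `&` X t.+1 @^-1` [set s'].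
  by apply/seteqP; split=> w /= => [[]|[-> ->]].
by apply: measurableI; exact: chain_state_meas.
Qed.

(** Each pair of states cut out of this event has probability
    [occ C t s * kern pi s s'] with a vanishing second factor. *)
Lemma prob_forbidden t : P (forbidden t) = 0%E.
Proof.
have mF := measurable_forbidden t.
rewrite -(fineK (fin_num_measure P _ mF)); congr EFin.
have E c : forbidden t `&` (fun w => (X t w, X t.+1 w)) @^-1` [set c] =
    if kern pi c.1 c.2 == 0 then X t @^-1` [set c.1] `&` X t.+1 @^-1` [set c.2]
    else set0.
  apply/seteqP; split=> w /=.
    by rewrite /forbidden /= => -[+ <-] /=; move/eqP => ->.
  case: ifP => // /eqP c0 [/= Xt Xt1]; rewrite /forbidden /= Xt Xt1.
  by rewrite -surjective_pairing.
rewrite (@prob_partition _ _ _ _ _ (fun w => (X t w, X t.+1 w)))//; last first.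
  move=> c; rewrite E; case: ifP => // _.
  by apply: measurableI; exact: chain_state_meas.
apply: big1 => c _; rewrite E; case: ifP => [/eqP c0|_]; last by rewrite measure0.
by rewrite occ_pair c0 mulr0.
Qed.

Lemma measurable_stray : measurable stray.
Proof. by apply: bigcupT_measurable => t; exact: measurable_forbidden. Qed.

Lemma prob_stray : P stray = 0%E.
Proof.
apply: measure_negligible; first exact: measurable_stray.
apply: negligible_bigcup => t; apply/negligibleP; last exact: prob_forbidden.
exact: measurable_forbidden.
Qed.

Lemma sink_stays w i j : ~ stray w -> is_sink M (X i w) -> (i <= j)%N ->
  X j w = X i w.
Proof.
move=> Nw iM /subnK <-; elim: (j - i)%N => [//|n IH].
rewrite addSn; apply: contrapT => /eqP XX; apply: Nw.
by exists (n + i)%N => //; rewrite /forbidden /= IH kern_sink0.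
Qed.

Lemma measurable_sat phi t : measurable [set w | sat lab (X t w) phi].
Proof.
exact: (measurable_fiber (chain_state_meas C t) [set s | sat lab s phi]).
Qed.

Definition until_event := [set w | not_until lab phi1 phi2 (fun n => X n w)].

Lemma measurable_until : measurable until_event.
Proof.
have -> : until_event = \bigcup_j ([set w | sat lab (X j w) phi2] `&`
    \bigcap_(i in [set i | (i < j)%N]) ~` [set w | sat lab (X i w) phi1]).
  apply/seteqP; split=> w /=.
    by move=> [j [j2 j1]]; exists j => //; split=> // i /j1/negP.
  by move=> [j _ [j2 j1]]; exists j; split=> // i /j1/negP.
apply: bigcupT_measurable => j; apply: measurableI; first exact: measurable_sat.
by apply: bigcap_measurableType => i _; apply: measurableC; exact: measurable_sat.
Qed.

(** Off [stray], a path in [phi2] at time [T] satisfies the until formula at its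
    first visit to [phi2]: an earlier state in [phi1] would be a sink, so it
    would still be the state at that visit and lie in [phi2]. *)
Lemma until_ge T : ((occ_in C B T)%:E <= P until_event)%E.
Proof.
rewrite -occ_inE -(measureU0 measurable_until measurable_stray prob_stray).
apply: le_measure; rewrite ?inE; first exact: measurable_sat.
  by apply: measurableU; [exact: measurable_until|exact: measurable_stray].
move=> w /= wT; have [sw|Nw] := pselect (stray w); [by right|left].
have ex : exists j, sat lab (X j w) phi2 by exists T.
(* The first visit to [phi2] witnesses the formula. *)
exists (ex_minn ex); case: ex_minnP => j j2 jmin; split=> // i ij.
apply/negP => i1; have := jmin i.
rewrite -(sink_stays Nw (sinkphi1 i1) (ltnW ij)) leqNgt ij => /(_ j2).
by [].
Qed.

(** The until event lies in the union of the events [X_j |= phi2].  Adding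
    [stray] to each makes them increase with [j] without changing their
    probabilities, so the union has the limit probability. *)
Lemma until_le x :
  (forall T, occ_in C B T <= x) -> (P until_event <= x%:E)%E.
Proof.
move=> occx; pose F j := [set w | sat lab (X j w) phi2] `|` stray.
have mF j : measurable (F j).
  by apply: measurableU; [exact: measurable_sat|exact: measurable_stray].
have PF j : P (F j) = (occ_in C B j)%:E.
  rewrite (measureU0 (measurable_sat phi2 j) measurable_stray prob_stray).
  exact: (occ_inE C B).
have ndF : nondecreasing_seq F.
  move=> i j ij; apply/subsetPset => w.
  have [sw _|Nw] := pselect (stray w); first by right.
  by case=> [Xi|//]; left; rewrite /= (sink_stays Nw (sinkphi2 Xi) ij).
have mUF := bigcupT_measurable F mF.
apply: (@le_trans _ _ (P (\bigcup_j F j))).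
  apply: le_measure; rewrite ?inE//; first exact: measurable_until.
  by move=> w [j [j2 _]]; exists j => //; left.
have cvF := @nondecreasing_cvg_mu _ _ _ P F mF mUF ndF.
rewrite -(cvg_lim (@ereal_hausdorff R) cvF).
apply: lime_le; first by apply/cvg_ex; exists (P (\bigcup_j F j)).
by apply: nearW => j; rewrite /= PF lee_fin.
Qed.

End until.

Arguments until_event {R S A M pi nu} C {AP} lab phi1 phi2.

Theorem mainTheorem4 (R : realType) (S A : finType) (M : mdp R S A)
    (AP : Type) (lab : S -> pred AP) (phi1 phi2 : pform AP)
    (p : R) (hp0 : 0 <= p) (hp1 : p <= 1) (b : comparison_op)
    (hsink : forall s, sat lab s (POr phi1 phi2) -> is_sink M s)
    (pi : policy M)
    (C : induced_chain pi (init M))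
    (Cs : forall s : S, induced_chain pi (point_mass R s))
    (eps : R) (heps0 : 0 < eps) (heps1 : eps < 1)
    (Tmix Teps : nat)
    (hmix : is_return_mixing_time
              (fun s T => total_cost (Cs s) (reach_cost M lab phi2) T) eps Tmix)
    (hTeps : (Tmix <= Teps)%N)
    (hcase :
      ((b = CmpGe \/ b = CmpGt) /\
         cmp b (total_cost C (reach_cost M lab phi2) Teps) p%:E)
      \/
      ((b = CmpLe \/ b = CmpLt) /\
         init_avoids M lab phi2 /\
         cmp b (total_cost C (reach_cost M lab phi2) Teps) (p - eps)%:E)) :
  chain_models C b p (not_until lab phi1 phi2).
Proof.
have sinkphi2 s : sat lab s phi2 -> is_sink M s.
  by move=> s2; apply: hsink; rewrite /= s2 orbT.
move: hcase; rewrite (total_reach_cost sinkphi2).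
set h := occ_in C (fun s => sat lab s phi2).
have h0_ge0 : 0 <= h 0%N.
  by apply: sumr_ge0 => s _; rewrite mulr_ge0 ?occ_ge0.
have lower : ((h Teps - h 0%N)%:E <=
    chain_pr C (until_event C lab phi1 phi2))%E.
  by apply: le_trans (until_ge C hsink Teps); rewrite lee_fin gerBl.
have upper : init_avoids M lab phi2 ->
    (chain_pr C (until_event C lab phi1 phi2) <=
     (h Teps - h 0%N + eps)%:E)%E.
  move=> avoid; apply: (until_le hsink) => t.
  have -> : h 0%N = 0.
    apply: big1 => s _; rewrite occ0.
    by case s2: (sat lab s phi2); rewrite ?mulr0// avoid ?mul0r.
  have := mixing_bound sinkphi2 (init_ge0 M) (init_sum1 M) C t (hmix.1) hTeps.
  rewrite -/h; lra.
rewrite /chain_models.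
case=> [[[]-> /=]|[[]-> [/upper{}upper /=]]] H.
- exact: le_trans H lower.
- exact: lt_le_trans H lower.
- apply: (le_trans upper); move: H; rewrite !lee_fin; lra.
- apply: (le_lt_trans upper); move: H; rewrite !lte_fin; lra.
Qed.
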